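(* Let $\mu$ be a probability measure on $\Omega=[0,1]^{\mathbb Z\times\mathbb N}$ which is stationary ergodic with respect to the $\mathbb Z$-shift $\theta$ and elliptic. Then $\mathbb P_0(A^+)\in\{0,1\}$ (and likewise $\mathbb P_0(A^-)\in\{0,1\}$).
   Context: Notation: $\mathbb N=\{1,2,\dots\}$. A cookie environment is $\omega\in\Omega=[0,1]^{\mathbb Z\times\mathbb N}$ (with the product Borel $\sigma$-algebra); $\omega(x,n)$ is the $n$-th cookie at site $x$. The shift $\theta$ acts by $(\theta\omega)(x,n)=\omega(x+1,n)$. A probability measure $\mu$ on $\Omega$ is stationary ergodic if it is $\theta$-invariant and ergodic for $\theta$, and elliptic if $\mu((0,1)^{\mathbb Z\times\mathbb N})=1$. For $\omega\in\Omega$ and $x\in\mathbb Z$, the excited random walk under $P_{\omega,x}$ is the process $(X_n)_{n\ge0}$ with $X_0=x$ and, conditionally on $X_0,\dots,X_{n-1}$, $X_n=X_{n-1}+1$ with probability $\omega(X_{n-1},\#\{k\le n-1:X_k=X_{n-1}\})$ and $X_n=X_{n-1}-1$ otherwise. The annealed law is $\mathbb P_x(\cdot)=\int_\Omega P_{\omega,x}(\cdot)\,d\mu(\omega)$. $A^+=\{\lim_{n\to\infty}X_n=+\infty\}$ (transience to the right), $A^-=\{\lim_{n\to\infty}X_n=-\infty\}$. *)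

(* Defs.v *)
From HB Require Import structures.
From mathcomp Require Import all_boot all_order all_algebra.
From mathcomp Require Import all_classical all_reals all_analysis.
Set Implicit Arguments. Unset Strict Implicit. Unset Printing Implicit Defensive.
Import Order.TTheory GRing.Theory Num.Theory.
Local Open Scope classical_set_scope.
Local Open Scope ring_scope.

(* Cookie environments: omega : int * nat -> R.  The coordinate (x, k)
   stores the (k+1)-th cookie at site x (cookies are indexed by N = {1,2,...}
   in the paper; we shift to 0-based indexing so that no spurious coordinate
   exists).  Values in (0,1) are enforced by ellipticity. *)
Section env_def.
Variable R : realType.

Definition env : Type := (int * nat -> R)%type.

HB.instance Definition _ := gen_eqMixin env.
HB.instance Definition _ := gen_choiceMixin env.
HB.instance Definition _ := isPointed.Build env (fun _ => 0).

Definition coord_gen : set (set env) :=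
  \bigcup_(i in [set: int * nat])
     @preimage_set_system env R setT (fun w => w i) measurable.

Definition env_measurable := <<s coord_gen >>.

Let env_measurable0 : env_measurable set0.
Proof. exact: sigma_algebra0. Qed.

Let env_measurableC (A : set env) :
  env_measurable A -> env_measurable (~` A).
Proof. exact: sigma_algebraC. Qed.

Let env_measurableU (F : (set env)^nat) :
  (forall i, env_measurable (F i)) -> env_measurable (\bigcup_i F i).
Proof. exact: sigma_algebra_bigcup. Qed.

Definition env_display : measure_display.
Proof. by constructor. Qed.

HB.instance Definition _ :=
  @isMeasurable.Build env_display env env_measurable
    env_measurable0 env_measurableC env_measurableU.

End env_def.
Arguments env R : clear implicits.

Definition shift (R : realType) (w : env R) : env R :=
  fun i => w (i.1 + 1, i.2)%R.

Definition stationary (R : realType) (mu : probability (env R) R) : Prop :=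
  forall B : set (env R), measurable B -> mu (@shift R @^-1` B) = mu B.

Definition ergodic (R : realType) (mu : probability (env R) R) : Prop :=
  forall B : set (env R), measurable B -> @shift R @^-1` B = B ->
    mu B = 0%E \/ mu B = 1%E.

Definition elliptic (R : realType) (mu : probability (env R) R) : Prop :=
  mu [set w : env R | forall i, 0 < w i < 1] = 1%E.

(* Excited random walk driven by a sequence u of uniforms:
   erw_traj w u x0 n = [:: X_0; X_1; ...; X_n].
   Step n -> n+1: with y = X_n and c = #{k <= n : X_k = y} (>= 1), the walk
   uses the c-th cookie at y, i.e. coordinate (y, c-1); it moves right iff
   u n < w (y, c-1), which has conditional probability w (y, c-1) when
   u n is uniform on [0,1] and independent of the past. *)
Fixpoint erw_traj (R : realType) (w : env R) (u : nat -> R) (x0 : int)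
    (n : nat) : seq int :=
  match n with
  | 0 => [:: x0]
  | n'.+1 =>
      let s := erw_traj w u x0 n' in
      let y := last x0 s in
      let c := count (pred1 y) s in
      rcons s (if u n' < w (y, c.-1) then y + 1 else y - 1)
  end.

Definition erw (R : realType) (w : env R) (u : nat -> R) (x0 : int) (n : nat)
  : int := last x0 (erw_traj w u x0 n).

Definition unif01 (R : realType) (A : set R) : \bar R :=
  (@lebesgue_measure R) (A `&` `[0, 1]).

(* (W, U_0, U_1, ...) on (S, P): W has law mu, the U_k are i.i.d. uniform on
   [0,1], and W, U_0, U_1, ... are mutually independent; stated as the
   product rule on all finite-dimensional measurable rectangles. *)
Definition annealed_coupling (R : realType) (d : measure_display)
    (S : measurableType d) (P : probability S R)
    (mu : probability (env R) R) (W : S -> env R) (U : nat -> S -> R) : Prop :=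
  measurable_fun [set: S] W /\
  (forall k, measurable_fun [set: S] (U k)) /\
  forall (n : nat) (B : set (env R)) (A : nat -> set R),
    measurable B -> (forall k, measurable (A k)) ->
    P [set s | B (W s) /\ forall k, (k < n)%N -> A k (U k s)] =
    (mu B * \prod_(k < n) unif01 (A k))%E.

Definition Aplus (R : realType) (d : measure_display) (S : measurableType d)
    (W : S -> env R) (U : nat -> S -> R) : set S :=
  [set s | forall M : int, exists N : nat, forall n, (N <= n)%N ->
     M <= erw (W s) (fun k => U k s) 0 n].

Definition Aminus (R : realType) (d : measure_display) (S : measurableType d)
    (W : S -> env R) (U : nat -> S -> R) : set S :=
  [set s | forall M : int, exists N : nat, forall n, (N <= n)%N ->
     erw (W s) (fun k => U k s) 0 n <= M].

(* Main.v *)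
Require Import Defs.
From HB Require Import structures.
From mathcomp Require Import all_boot all_order all_algebra.
From mathcomp Require Import all_classical all_reals all_analysis.
From mathcomp Require Import measurable_realfun zify lra.
Set Implicit Arguments. Unset Strict Implicit. Unset Printing Implicit Defensive.
Import Order.TTheory GRing.Theory Num.Theory.
Local Open Scope classical_set_scope.
Local Open Scope ring_scope.

(* Realise the walk with stacks of arrows: put i.i.d. uniform variables v on
   the cookies and let the cookie i point to the right iff v(i) < w(i).  The
   walk is then a deterministic function of its starting point and of
   (w, v), whose law mu (x) nu is invariant under the simultaneous shift T.

   Let R_1, R_2, ... be the successive excursions into [1, oo) and
   L_1, L_2, ... those into (-oo, 0]; each of the two sequences depends only
   on the arrows of its own half-line.  The walk from 0 runs through
   L_1 R_1 L_2 R_2 ... and the walk from 1 through R_1 L_1 R_2 L_2 ..., so if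
   the former escapes to +oo during R_r, then so does the latter: the event E
   that the walk from 0 tends to +oo satisfies E <= T^-1 E, hence E = T^-1 E
   almost surely.

   Such an event is trivial.  Given w, the arrows in distant windows are
   independent, so the invariance of E makes it independent of v given w;
   hence E = G x (all v) up to a null set, where G <= shift^-1 G, and mu(G) is
   0 or 1 by ergodicity. *)

(** * Stack walks *)

Section StackWalk.
Implicit Types (a : int * nat -> bool) (phi : int -> int) (n : nat) (x y z : int).

Lemma sum_bool_homo (F : nat -> bool) :
  {homo (fun n => \sum_(k < n) F k)%N : m n / (m <= n)%N}.
Proof.
move=> m n /subnK <-; elim: (n - m)%N => [//|k IH].
by rewrite addSn big_ord_recr /=; exact: leq_trans IH (leq_addr _ _).
Qed.

Definition hop (b : bool) (y : int) : int := if b then y + 1 else y - 1.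

(* The walker at [y] having already left [y] exactly [l y] times follows the
   arrow [a (y, l y)]; its target is then moved by [phi].  The case
   [phi = id] is the excited walk itself, the cases [phi = max 1] and
   [phi = min 0] are its restrictions to the two half-lines, where an exit is
   replaced by an immediate re-entry. *)
Fixpoint stack_walk phi a x n : int * (int -> nat) :=
  if n is n'.+1 then
    let s := stack_walk phi a x n' in
    (phi (hop (a (s.1, s.2 s.1)) s.1), fun z => (s.2 z + (z == s.1))%N)
  else (x, fun=> 0%N).

Definition walk_target phi a x n : int :=
  let s := stack_walk phi a x n in hop (a (s.1, s.2 s.1)) s.1.

Definition right_walk a := stack_walk (Num.max 1) a 1.
Definition left_walk a := stack_walk (Num.min 0) a 0.

(** An exit is visible only in the target before reflection, as [max 1] sends 0 straight back to 1.
    The sum is the number of right excursions completed in [n] steps of the right clock. *)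
Definition right_exits a n : nat :=
  \sum_(k < n) (walk_target (Num.max 1) a 1 k == 0)%R.
Definition left_exits a n : nat :=
  \sum_(k < n) (walk_target (Num.min 0) a 0 k == 1)%R.

Lemma right_exits_homo a : {homo right_exits a : m n / (m <= n)%N}.
Proof. exact: (sum_bool_homo (fun k => walk_target (Num.max 1) a 1 k == 0)). Qed.

Lemma left_exits_homo a : {homo left_exits a : m n / (m <= n)%N}.
Proof. exact: (sum_bool_homo (fun k => walk_target (Num.min 0) a 0 k == 1)). Qed.

(** * Splitting the walk at the edge between 0 and 1 *)

Definition pos a x n : int := (stack_walk id a x n).1.

Definition right_time a x n : nat := \sum_(k < n) (1 <= pos a x k)%R.
Definition left_time a x n : nat := \sum_(k < n) (pos a x k <= 0)%R.

Lemma right_time_add_left_time a x n :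
  (right_time a x n + left_time a x n = n)%N.
Proof.
rewrite /right_time /left_time -big_split /= (eq_bigr (fun=> 1%N)).
  by rewrite sum1_card card_ord.
by move=> k _; lia.
Qed.

(** Each half-line has its own clock, and its reflected walk waits at the entrance while the walker
    is on the other side. The last equation holds because crossings of the edge between 0 and 1
    alternate. *)
Lemma half_line_decomposition a (b : bool) x n : x = (b : nat)%:Z ->
  [/\ (right_walk a (right_time a x n)).1 = Num.max 1 (pos a x n),
      (left_walk a (left_time a x n)).1 = Num.min 0 (pos a x n),
      forall z, (stack_walk id a x n).2 z =
        if 1 <= z then (right_walk a (right_time a x n)).2 z
        else (left_walk a (left_time a x n)).2 z &
      (left_exits a (left_time a x n) + b =
       right_exits a (right_time a x n) + (1 <= pos a x n)%R)%N].
Proof.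
move=> xb; elim: n => [|n [IHr IHl IHc IHe]].
  rewrite /right_time /left_time /left_exits /right_exits !big_ord0 /pos /=.
  rewrite {}xb; split; [by case: b|by case: b|by move=> z; rewrite if_same|by case: b].
rewrite {1 3}/right_time {1 3}/left_time.
have [x1|x0] := boolP (1 <= pos a x n).
  have rS : right_time a x n.+1 = (right_time a x n).+1.
    by rewrite /right_time big_ord_recr /= x1 addn1.
  have lS : left_time a x n.+1 = left_time a x n.
    rewrite /left_time big_ord_recr /=.
    by rewrite (_ : (pos a x n <= 0) = false) ?addn0 //; lia.
  (* The right walk is at the same site with the same count there, so both read the same arrow, and
     the targets agree before reflection. *)
  have posS : pos a x n.+1 = walk_target (Num.max 1) a 1 (right_time a x n).
    rewrite /walk_target -/(right_walk a _) IHr (max_r x1) /pos /= IHc.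
    by rewrite -/(pos a x n) x1.
  have hS : pos a x n.+1 = hop (a (pos a x n, (stack_walk id a x n).2 (pos a x n)))
     (pos a x n) by [].
  have p0 : 0 <= pos a x n.+1 by rewrite hS /hop; case: ifP => _; lia.
  rewrite -/(right_time a x n.+1) -/(left_time a x n.+1) rS lS; split.
  - by rewrite posS.
  - by rewrite IHl; lia.
  - move=> z; rewrite /= IHc; case: ifPn => z1.
      by rewrite -/(right_walk _ _) IHr (max_r x1).
    by rewrite -/(pos a x n) (_ : (z == pos a x n) = false) ?addn0 //; lia.
  - rewrite {1}/right_exits big_ord_recr /= -/(right_exits _ _) -posS; lia.
have rS : right_time a x n.+1 = right_time a x n.
  by rewrite /right_time big_ord_recr /= (negbTE x0) addn0.
have lS : left_time a x n.+1 = (left_time a x n).+1.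
  rewrite /left_time big_ord_recr /=.
  by rewrite (_ : (pos a x n <= 0) = true) ?addn1 //; lia.
have xl : Num.min 0 (pos a x n) = pos a x n by lia.
have posS : pos a x n.+1 = walk_target (Num.min 0) a 0 (left_time a x n).
  rewrite /walk_target -/(left_walk a _) IHl xl /pos /= IHc.
  by rewrite -/(pos a x n) (negbTE x0).
have hS : pos a x n.+1 = hop (a (pos a x n, (stack_walk id a x n).2 (pos a x n)))
   (pos a x n) by [].
have p0 : pos a x n.+1 <= 1 by rewrite hS /hop; case: ifP => _; lia.
rewrite -/(right_time a x n.+1) -/(left_time a x n.+1) rS lS; split.
- by rewrite IHr; lia.
- by rewrite posS.
- move=> z; rewrite /= IHc; case: ifPn => z1.
    by rewrite -/(pos a x n) (_ : (z == pos a x n) = false) ?addn0 //; lia.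
  by rewrite -/(left_walk _ _) IHl xl.
- rewrite {1}/left_exits big_ord_recr /= -/(left_exits _ _) -posS; lia.
Qed.

Definition goes_right a x :=
  forall M : int, exists N : nat, forall n, (N <= n)%N -> M <= pos a x n.
Definition goes_left a x :=
  forall M : int, exists N : nat, forall n, (N <= n)%N -> pos a x n <= M.

(** The walk from 0 spends a finite time [L] on the left, and its last right excursion never ends.
    The walk from 1 begins on the right, so it would have to complete that endless excursion before
    making [L] steps on the left. *)
Lemma goes_right_succ a : goes_right a 0 -> goes_right a 1.
Proof.
move=> a0.
have [N N1] := a0 1.
pose L := left_time a 0 N.
have lL n : (N <= n)%N -> left_time a 0 n = L.
  elim: n => [|n IH]; first by rewrite leqn0 /L => /eqP ->.
  rewrite leq_eqVlt => /orP[/eqP Nn|]; first by rewrite /L Nn.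
  rewrite ltnS => Nn.
  rewrite /left_time big_ord_recr /= -/(left_time _ _ _) IH //.
  by have := N1 _ Nn; case: (pos a 0 n <= 0) / idP => //; lia.
have rL r : (N <= r)%N -> right_time a 0 (r + L) = r.
  move=> Nr; have := right_time_add_left_time a 0 (r + L).
  by rewrite lL; [lia|lia].
(* When the walk from 0 is on the right, its right exits are one behind its left exits. Large [r]
   suffice, by monotonicity. *)
have exR r : (right_exits a r < left_exits a L)%N.
  have [_ _ _] := @half_line_decomposition a false 0 (maxn r N + L) erefl.
  have Nr : (N <= maxn r N + L)%N by lia.
  rewrite /= rL ?leq_maxr // lL // N1 //.
  have : (right_exits a r <= right_exits a (maxn r N))%N.
    by apply: right_exits_homo; rewrite leq_maxl.
  lia.
have l1 n : (left_time a 1 n < L)%N.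
  have [_ _ _] := @half_line_decomposition a true 1 n erefl; rewrite /= => e.
  rewrite ltnNge; apply/negP => /(left_exits_homo a) lL1.
  have := exR (right_time a 1 n); move: e lL1.
  by case: (1 <= pos a 1 n); lia.
(* The walks are compared through [max 1], which hides nothing at levels of at least 2. *)
move=> M; have [N' N'M] := a0 (Num.max M 2).
exists (maxn N N' + L)%N => n Nn.
have := right_time_add_left_time a 1 n; have := l1 n => ln rn.
have [+ _ _ _] := @half_line_decomposition a true 1 n erefl.
have [+ _ _ _] := @half_line_decomposition a false 0 (right_time a 1 n + L) erefl.
rewrite /= rL; last by lia.
move=> -> ; have := N'M (right_time a 1 n + L)%N; lia.
Qed.

(** Mirror image of [goes_right_succ]: exchanging the half-lines also exchanges the starting points
    0 and 1, which reverses the implication. *)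
Lemma goes_left_pred a : goes_left a 1 -> goes_left a 0.
Proof.
move=> a1.
have [N N1] := a1 0.
pose L := right_time a 1 N.
have lL n : (N <= n)%N -> right_time a 1 n = L.
  elim: n => [|n IH]; first by rewrite leqn0 /L => /eqP ->.
  rewrite leq_eqVlt => /orP[/eqP Nn|]; first by rewrite /L Nn.
  rewrite ltnS => Nn.
  rewrite /right_time big_ord_recr /= -/(right_time _ _ _) IH //.
  by have := N1 _ Nn; case: (1 <= pos a 1 n) / idP => //; lia.
have rL r : (N <= r)%N -> left_time a 1 (r + L) = r.
  move=> Nr; have := right_time_add_left_time a 1 (r + L).
  by rewrite lL; [lia|lia].
have exL l : (left_exits a l < right_exits a L)%N.
  have [_ _ _] := @half_line_decomposition a true 1 (maxn l N + L) erefl.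
  have Nr : (N <= maxn l N + L)%N by lia.
  rewrite /= rL ?leq_maxr // lL //.
  have -> : (1 <= pos a 1 (maxn l N + L)) = false by have := N1 _ Nr; lia.
  have : (left_exits a l <= left_exits a (maxn l N))%N.
    by apply: left_exits_homo; rewrite leq_maxl.
  lia.
have l0 n : (right_time a 0 n < L)%N.
  have [_ _ _] := @half_line_decomposition a false 0 n erefl; rewrite /= => e.
  rewrite ltnNge; apply/negP => /(right_exits_homo a) lL1.
  have := exL (left_time a 0 n); move: e lL1.
  by case: (1 <= pos a 0 n); lia.
move=> M; have [N' N'M] := a1 (Num.min M (-1)).
exists (maxn N N' + L)%N => n Nn.
have := right_time_add_left_time a 0 n; have := l0 n => ln rn.
have [_ + _ _] := @half_line_decomposition a false 0 n erefl.
have [_ + _ _] := @half_line_decomposition a true 1 (left_time a 0 n + L) erefl.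
rewrite /= rL; last by lia.
move=> -> ; have := N'M (left_time a 0 n + L)%N; lia.
Qed.

Lemma pos_shift a x n :
  pos a (x + 1) n = pos (fun i => a (i.1 + 1, i.2)) x n + 1.
Proof.
suff: pos a (x + 1) n = pos (fun i => a (i.1 + 1, i.2)) x n + 1 /\
  forall z, (stack_walk id a (x + 1) n).2 (z + 1) =
            (stack_walk id (fun i => a (i.1 + 1, i.2)) x n).2 z by case.
rewrite /pos; elim: n => [//|n [IHp IHc]] /=; rewrite IHp IHc; split.
  by rewrite /hop /=; case: (a _) => //; rewrite addrAC.
by move=> z; rewrite IHc (inj_eq (addIr 1)).
Qed.

(* [dec k i] is the direction of the step at time [k] when it uses the
   cookie [i]. *)
Fixpoint walk_traj (dec : nat -> int * nat -> bool) x n : seq int :=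
  if n is n'.+1 then
    let s := walk_traj dec x n' in
    let y := last x s in
    rcons s (hop (dec n' (y, (count (pred1 y) s).-1)) y)
  else [:: x].

Lemma last_walk_traj a x n : last x (walk_traj (fun=> a) x n) = pos a x n.
Proof.
(* The list counts the current visit, the stack walk only departures; the last summand corrects for
   this. *)
suff: last x (walk_traj (fun=> a) x n) = pos a x n /\
  forall z, count (pred1 z) (walk_traj (fun=> a) x n) =
            ((stack_walk id a x n).2 z + (z == pos a x n))%N by case.
elim: n => [|n [IHp IHc]] /=; first by split=> // z; rewrite addn0 eq_sym.
rewrite last_rcons IHp IHc eqxx addn1 /=; split=> // z.
by rewrite -cats1 count_cat IHc /= addn0 -/(pos a x n) (eq_sym (hop _ _)).
Qed.

Lemma size_walk_traj dec x n : size (walk_traj dec x n) = n.+1.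
Proof. by elim: n => [//|n IH] /=; rewrite size_rcons IH. Qed.

Lemma nth_walk_traj dec x n k : (k <= n)%N ->
  nth 0 (walk_traj dec x n) k = last x (walk_traj dec x k).
Proof.
elim: n => [|n IH]; first by rewrite leqn0 => /eqP ->.
rewrite leq_eqVlt => /orP[/eqP ->|kn].
  by rewrite /= last_rcons nth_rcons size_walk_traj ltnn eqxx.
by rewrite /= nth_rcons size_walk_traj kn IH.
Qed.

(** The prefix includes the current visit, so the predecessor gives the 0-based index of the cookie
    used at step [k]. *)
Definition visit (g : seq int) (k : nat) : int * nat :=
  (nth 0 g k, (count (pred1 (nth 0 g k)) (take k.+1 g)).-1).

Lemma visit_rcons g y k : (k < size g)%N -> visit (rcons g y) k = visit g k.
Proof.
move=> kg; rewrite /visit nth_rcons kg -cats1 takel_cat //.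
Qed.

(** A later visit to the same site has a strictly larger count, so no cookie is used twice. *)
Lemma visit_inj g : {in [pred k | (k < size g)%N] &, injective (visit g)}.
Proof.
suff lt j k : (j < k)%N -> (k < size g)%N -> visit g j <> visit g k.
  move=> j k; rewrite !inE => jg kg e.
  have [/lt /(_ kg)//|/lt /(_ jg)|//] := ltngtP j k.
  by rewrite e.
move=> jk kg [] e1.
rewrite e1 (take_nth 0 kg) -cats1 count_cat /= eqxx.
have jg := ltn_trans jk kg.
have : (0 < count (pred1 (nth 0%R g k)) (take j.+1 g))%N.
  by rewrite (take_nth 0 jg) -cats1 count_cat /= e1 eqxx addn1.
have : (count (pred1 (nth 0%R g k)) (take j.+1 g) <=
        count (pred1 (nth 0%R g k)) (take k g))%N.
  by rewrite -(subnKC jk) takeD count_cat leq_addr.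
by move: (count _ (take j.+1 g)) (count _ (take k g)) => u v /=; lia.
Qed.

(** Once [g] is fixed the cookies it uses are deterministic, so following [g] splits into one
    condition per step. *)
Lemma walk_trajP dec x n g : walk_traj dec x n = g <->
  [/\ size g = n.+1, nth 0 g 0 = x &
   forall k, (k < n)%N ->
     nth 0 g k.+1 = hop (dec k (visit g k)) (nth 0 g k)].
Proof.
elim: n g => [|n IH] g.
  split=> [<- //|[]]; case: g => [//|y [|//]] _ /= -> _ //.
case/lastP: g => [|g y]; first by split=> [/(congr1 size)|[]//]; rewrite size_walk_traj.
have lastE : walk_traj dec x n = g -> visit (rcons g y) n =
    (last x g, (count (pred1 (last x g)) g).-1) /\ nth 0 (rcons g y) n = last x g.
  move=> gE; have sg : size g = n.+1 by rewrite -gE size_walk_traj.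
  have nE : nth 0 (rcons g y) n = last x g.
    rewrite nth_rcons sg leqnn; case: (g) sg => // z g' [<-].
    by rewrite /= (last_nth 0).
  by split=> //; rewrite /visit nE -cats1 take_size_cat.
split=> [/= /eqP|[]].
  rewrite eqseq_rcons => /andP[/eqP gE /eqP yE].
  have [vE nE] := lastE gE.
  have [sg g0 gk] := (IH g).1 gE.
  rewrite size_rcons sg; split=> //.
    by rewrite nth_rcons sg.
  move=> k; rewrite ltnS leq_eqVlt => /orP[/eqP ->|kn].
    by rewrite vE nE -yE gE nth_rcons sg ltnn eqxx.
  have kn1 : (k < n.+1)%N by exact: ltnW.
  by rewrite !nth_rcons sg kn1 ltnS kn visit_rcons ?sg ?gk.
rewrite size_rcons => -[sg] g0 gk.
have gE : walk_traj dec x n = g.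
  apply/IH; split=> //.
    by move: g0; rewrite nth_rcons sg.
  move=> k kn; have := gk k (ltnW kn).
  have kn1 : (k < n.+1)%N by exact: ltnW.
  by rewrite !nth_rcons sg kn1 ltnS kn visit_rcons ?sg.
have [vE nE] := lastE gE.
by have := gk n (leqnn _); rewrite vE nE nth_rcons sg ltnn eqxx /= gE => ->.
Qed.

End StackWalk.

(** * Cylinder sets and i.i.d. coordinates *)

Lemma measurable_env_coord (R : realType) (i : int * nat) :
  measurable_fun [set: env R] (fun w : env R => w i).
Proof.
move=> _ Y mY; rewrite setTI; apply: sub_sigma_algebra.
by exists i => //; exists Y => //; rewrite setTI.
Qed.

Lemma measurable_env_fun (R : realType) d (S : measurableType d)
  (f : S -> env R) : (forall i, measurable_fun [set: S] (fun s => f s i)) ->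
  measurable_fun [set: S] f.
Proof.
move=> mf; apply: (measurability (@coord_gen R)) => //.
move=> _ [_ [i _ [Y mY <-]] <-]; rewrite !setTI.
by have := mf i measurableT _ mY; rewrite setTI.
Qed.

Lemma measurable_shift (R : realType) : measurable_fun setT (@Defs.shift R).
Proof. by apply: measurable_env_fun => i; exact: measurable_env_coord. Qed.

Section Cylinder.
Context {R : realType}.
Implicit Types (sigma : nat -> int * nat) (N : nat) (A : nat -> set R).

Definition cylinder sigma N A : set (env R) :=
  [set v | forall k, (k < N)%N -> A k (v (sigma k))].

Definition cylinders sigma : set (set (env R)) :=
  [set C | exists N A, (forall k, measurable (A k)) /\ C = cylinder sigma N A].

Lemma cylinderE sigma N A : cylinder sigma N A =
  \bigcap_(k < N) ((fun v : env R => v (sigma k)) @^-1` A k).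
Proof. by apply/seteqP; split => v /= h k; exact: h. Qed.

Lemma measurable_cylinder sigma N A : (forall k, measurable (A k)) ->
  measurable (cylinder sigma N A).
Proof.
move=> mA; rewrite cylinderE; apply: bigcap_measurableType => k _.
by rewrite -[X in measurable X]setTI; exact: measurable_env_coord.
Qed.

Lemma cylinders_setT sigma : cylinders sigma setT.
Proof.
by exists 0%N, (fun=> setT); split=> //; apply/seteqP; split.
Qed.

Lemma cylinders_setI sigma : setI_closed (cylinders sigma).
Proof.
move=> _ _ [N [A [mA ->]]] [M [B [mB ->]]].
exists (maxn N M), (fun k => (if (k < N)%N then A k else setT) `&`
                            (if (k < M)%N then B k else setT)); split.
  by move=> k; apply: measurableI; case: ifP.
apply/seteqP; split => [v [hA hB] k _|v h].
  by split; case: ifPn => // ?; [exact: hA|exact: hB].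
split=> k kN.
  by have [] := h k (leq_trans kN (leq_maxl _ _)); rewrite kN.
by have [] := h k (leq_trans kN (leq_maxr _ _)); rewrite kN.
Qed.

(** The first side is arbitrary, as the law of the environment need not be a product; the second is
    a cylinder, where an i.i.d. law is explicit. *)
Definition rectangles d (T : measurableType d) sigma : set (set (T * env R)) :=
  [set D | exists B C, [/\ measurable B, cylinders sigma C & D = B `*` C]].

Lemma rectangles_setI d (T : measurableType d) sigma :
  setI_closed (@rectangles d T sigma).
Proof.
move=> _ _ [B [C [mB sC ->]]] [B' [C' [mB' sC' ->]]].
exists (B `&` B'), (C `&` C'); split; rewrite ?setXI //.
  exact: measurableI.
exact: cylinders_setI.
Qed.

Lemma measurable_rectangles d (T : measurableType d) sigma :
  (forall i, exists k, sigma k = i) ->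
  @measurable _ (T * env R)%type = <<s @rectangles d T sigma >>.
Proof.
move=> sigma_surj; apply/seteqP; split; last first.
  apply: smallest_sub; first exact: sigma_algebra_measurable.
  move=> _ [B [_ [mB [N [A [mA ->]]] ->]]].
  by apply: measurableX => //; exact: measurable_cylinder.
apply: smallest_sub; first exact: smallest_sigma_algebra.
move=> D [[B mB <-]|[C mC <-]].
  apply: sub_sigma_algebra; exists B, setT; split=> //.
    exact: cylinders_setT.
  by rewrite setTI setXT.
rewrite setTI.
(* The sets whose preimage under [snd] is generated by rectangles form a sigma-algebra containing
   the coordinate events. *)
suff : <<s @coord_gen R >> `<=`
    [set C | <<s @rectangles d T sigma >> (snd @^-1` C)] by exact.
apply: smallest_sub.
  have [s0 sC sU] := smallest_sigma_algebra setT (@rectangles d T sigma).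
  split.
  - by rewrite /= preimage_set0.
  - move=> X /= /sC; rewrite !setTD.
    by rewrite preimage_setC.
  - by move=> F /= hF; rewrite preimage_bigcup; exact: sU.
move=> _ [i _ [Y mY <-]] /=; rewrite setTI.
have [k <-] := sigma_surj i.
apply: sub_sigma_algebra.
exists setT, (cylinder sigma k.+1 (fun j => if j == k then Y else setT)).
split=> //.
- exists k.+1, (fun j => if j == k then Y else setT); split=> // j.
  by case: ifP.
- apply/seteqP; split=> [[t v] /= Yv|[t v] /= [_ /(_ k)]].
    by split=> // j _; case: eqP => [->|].
  by rewrite eqxx; apply.
Qed.

(** * Independent uniform coordinates *)

Definition iid (nu : set (env R) -> \bar R) sigma :=
  forall N A, (forall k, measurable (A k)) ->
  nu (cylinder sigma N A) = (\prod_(k < N) unif01 (A k))%E.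

Lemma unif01_setT : unif01 [set: R] = 1%E.
Proof. by rewrite /unif01 setTI lebesgue_measure_itv /= lte01 oppr0 adde0. Qed.

(** Constraints along [tau] are constraints along [sigma] with the remaining coordinates free, and a
    free coordinate contributes the factor 1. *)
Lemma iid_injective (nu : set (env R) -> \bar R) sigma tau N A :
  (forall i, exists k, sigma k = i) -> iid nu sigma ->
  {in [pred k | (k < N)%N] &, injective tau} -> (forall k, measurable (A k)) ->
  nu (cylinder tau N A) = (\prod_(k < N) unif01 (A k))%E.
Proof.
move=> /choice[s sK] nu_iid tau_inj mA.
pose rk k := s (tau k).
have rkI (j k : 'I_N) : rk j = rk k -> j = k.
  move=> /(congr1 sigma); rewrite /rk !sK => e; apply/val_inj/tau_inj => //=;
  by rewrite inE.
pose M := (\max_(k < N) rk k).+1.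
have rkM (k : 'I_N) : (rk k < M)%N by rewrite ltnS; exact: leq_bigmax.
(* By injectivity at most one [k] contributes; the empty intersection is the whole line. *)
pose A' m := \bigcap_(k in [set k | (k < N)%N /\ rk k = m]) A k.
have mA' m : measurable (A' m) by exact: bigcap_measurableType.
have -> : cylinder tau N A = cylinder sigma M A'.
  apply/seteqP; split=> [v h m mM k [kN km]|v h k kN].
    by rewrite -km /rk sK; exact: h.
  have := h _ (rkM (Ordinal kN)) k; rewrite /rk sK; exact.
rewrite nu_iid //.
rewrite [RHS](partition_big (fun k => Ordinal (rkM k)) xpredT) //=.
apply: eq_bigr => m _.
have [[k km]|nk] := pselect (exists k : 'I_N, Ordinal (rkM k) = m).
  rewrite (big_pred1 k) => [|j /=]; last first.
    rewrite -km; apply/eqP/eqP => [|-> //].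
    by move=> /(congr1 val) /= /rkI.
  congr unif01; apply/seteqP; split=> x /=.
    by apply; split=> //; rewrite -km.
  move=> Akx j [jN jm].
  suff /(congr1 val) /= -> : Ordinal jN = k by [].
  by apply: rkI; rewrite /= jm -km.
rewrite big_pred0 => [|j]; last first.
  by apply/negP => /eqP jm; apply: nk; exists j.
rewrite -unif01_setT; congr unif01; apply/seteqP; split=> // x _ j [jN jm].
by exfalso; apply: nk; exists (Ordinal jN); apply: val_inj.
Qed.

End Cylinder.

(** * Monotone events of the shift on the product space *)

Lemma measurable_preimageT d1 d2 (T1 : measurableType d1)
  (T2 : measurableType d2) (f : T1 -> T2) (A : set T2) :
  measurable_fun setT f -> measurable A -> measurable (f @^-1` A).
Proof. by move=> mf mA; rewrite -[X in measurable X]setTI; exact: mf. Qed.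

Lemma exists_pushforward_measure (R : realType) d1 d2 (T1 : measurableType d1)
  (T2 : measurableType d2) (m : {measure set T1 -> \bar R}) (f : T1 -> T2) :
  measurable_fun setT f ->
  exists p : {measure set T2 -> \bar R}, forall A, p A = m (f @^-1` A).
Proof.
move=> mf.
by unshelve eexists (pushforward m f).
Qed.

Section MixedRectangles.
Context {R : realType} d {T : measurableType d}.

Lemma rectangle_measure_unique (sigma : nat -> int * nat)
  (m1 m2 : {measure set (T * env R) -> \bar R}) :
  (forall i, exists k, sigma k = i) -> (m1 setT < +oo)%E ->
  (forall B C, measurable B -> cylinders sigma C ->
    m1 (B `*` C) = m2 (B `*` C)) ->
  forall D, measurable D -> m1 D = m2 D.
Proof.
move=> sigma_surj m1oo m12.
apply: (measure_unique (rectangles sigma) (fun=> setT)) => //.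
- exact: measurable_rectangles.
- exact: rectangles_setI.
- move=> _; exists setT, setT; split; rewrite ?setXTT //.
  exact: cylinders_setT.
- by apply/seteqP; split=> // x _; exists 0%N.
- by move=> _ [B [C [mB sC ->]]]; exact: m12.
Qed.

End MixedRectangles.

Definition pair_shift (R : realType) (z : env R * env R) : env R * env R :=
  (Defs.shift z.1, Defs.shift z.2).

Lemma measurable_pair_shift (R : realType) :
  measurable_fun setT (@pair_shift R).
Proof.
by apply: measurable_fun_pair; apply: measurableT_comp => //;
  exact: measurable_shift.
Qed.

Lemma measurable_iter d (T : measurableType d) (f : T -> T) n :
  measurable_fun setT f -> measurable_fun setT (iter n f).
Proof.
move=> mf; elim: n => [|n IH]; first exact: measurable_id.
exact: measurableT_comp mf IH.
Qed.

Lemma iter_pair_shift (R : realType) n (z : env R * env R) :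
  iter n (@pair_shift R) z =
  (iter n (@Defs.shift R) z.1, iter n (@Defs.shift R) z.2).
Proof. by elim: n => [|n IH] /=; [case: z|rewrite IH]. Qed.

Lemma iter_shiftE (R : realType) n (v : env R) i :
  iter n (@Defs.shift R) v i = v (i.1 + n%:Z, i.2).
Proof.
elim: n i => [|n IH] i /=; first by rewrite addr0; case: i.
by rewrite /Defs.shift IH /= -addrA -[1]/(1%:Z) -PoszD add1n.
Qed.

Section ErgodicProduct.
Context {R : realType} (mu nu : probability (env R) R).
Variable sigma : nat -> int * nat.
Hypotheses (mu_stat : stationary mu) (mu_erg : ergodic mu).
Hypothesis sigma_surj : forall i, exists k, sigma k = i.
Hypothesis sigma_inj : injective sigma.
Hypothesis nu_iid : iid nu sigma.

Let m : probability (env R * env R)%type R := (mu \x nu)%E.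

Let m_rectangle B C : measurable B -> measurable C ->
  m (B `*` C) = (mu B * nu C)%E.
Proof. exact: product_measure1E. Qed.

Lemma iter_shift_cylinder n (tau : nat -> int * nat) N (A : nat -> set R) :
  iter n (@Defs.shift R) @^-1` cylinder tau N A =
  cylinder (fun k => ((tau k).1 + n%:Z, (tau k).2)) N A.
Proof.
by apply/seteqP; split=> v /= h k kN; move: (h k kN); rewrite iter_shiftE.
Qed.

Lemma shift_cylinder_measure n C : cylinders sigma C ->
  nu (iter n (@Defs.shift R) @^-1` C) = nu C.
Proof.
move=> [N [A [mA ->]]]; rewrite iter_shift_cylinder nu_iid //.
rewrite (iid_injective sigma_surj) // => j k _ _ [] /addIr e1 e2.
by apply: sigma_inj; move: e1 e2; case: (sigma j) (sigma k) => ? ? [? ?] /= -> ->.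
Qed.

(** Rectangles determine a finite measure, and on them stationarity of [mu] and the product form of
    [nu] give the invariance. *)
Lemma pair_shift_measure n D : measurable D ->
  m (iter n (@pair_shift R) @^-1` D) = m D.
Proof.
move=> mD; elim: n => [//|n <-].
have mT : measurable (iter n (@pair_shift R) @^-1` D).
  apply: measurable_preimageT mD; apply: measurable_iter.
  exact: measurable_pair_shift.
have [p pE'] := exists_pushforward_measure m (@measurable_pair_shift R).
have pE A : p A = m (@pair_shift R @^-1` A) by exact: pE'.
have -> : iter n.+1 (@pair_shift R) @^-1` D =
  @pair_shift R @^-1` (iter n (@pair_shift R) @^-1` D).
  apply/funext => z; rewrite /preimage /=. by rewrite -iterS iterSr.
transitivity (p (iter n (@pair_shift R) @^-1` D)); first by rewrite pE.
apply: (rectangle_measure_unique (sigma := sigma)) => //.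
  by rewrite pE preimage_setT; apply: le_lt_trans (ltry 1); exact: probability_le1.
move=> B C mB sC; rewrite pE; transitivity (m (B `*` C)) => //.
have mC : measurable C by case: sC => N [A [mA ->]]; exact: measurable_cylinder.
rewrite -[_ @^-1` _]/((@Defs.shift R @^-1` B) `*` (iter 1 (@Defs.shift R) @^-1` C)).
rewrite !m_rectangle //.
- by rewrite mu_stat // (shift_cylinder_measure 1).
- exact: measurable_preimageT (@measurable_shift R) mB.
- exact: measurable_preimageT (@measurable_shift R) mC.
Qed.

Lemma shift_measure C : measurable C -> nu (@Defs.shift R @^-1` C) = nu C.
Proof.
move=> mC; have := pair_shift_measure 1 (measurableX measurableT mC).
rewrite -[_ @^-1` _]/(setT `*` (@Defs.shift R @^-1` C)) !m_rectangle //.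
  by rewrite probability_setT !mul1e.
exact: measurable_preimageT (@measurable_shift R) mC.
Qed.

Lemma cylinders_shift_indep C C' : cylinders sigma C -> cylinders sigma C' ->
  exists n0, forall n, (n0 <= n)%N ->
  nu (C `&` iter n (@Defs.shift R) @^-1` C') = (nu C * nu C')%E.
Proof.
move=> sC sC'.
have [N [A [mA CE]]] := sC; have [N' [A' [mA' CE']]] := sC'.
(* A shift by more than [b] makes the sites of [C'] disjoint from those of [C], so that [tau], which
   lists the former after the latter, is injective. *)
pose b : nat := (\max_(k < N) `|(sigma k).1| + \max_(k < N') `|(sigma k).1|)%N.
exists b.+1 => n bn.
pose tau k := if (k < N)%N then sigma k else
  ((sigma (k - N)%N).1 + n%:Z, (sigma (k - N)%N).2).
pose A2 k := if (k < N)%N then A k else A' (k - N)%N.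
have ltnNN k : (N + k < N)%N = false by rewrite ltnNge leq_addr.
have -> : C `&` iter n (@Defs.shift R) @^-1` C' = cylinder tau (N + N') A2.
  rewrite CE CE' iter_shift_cylinder.
  apply/seteqP; split=> [v [h h'] k kN|v h].
    rewrite /A2 /tau; case: ltnP => kN1; first exact: h.
    by apply: h'; rewrite ltn_subLR.
  split=> k kN; have := h k; have := h (N + k)%N; rewrite /A2 /tau.
    by move=> _; rewrite kN; apply; exact: ltn_addr.
  by rewrite ltnNN addKn ltn_add2l => + _; apply.
rewrite (iid_injective sigma_surj) //; last first.
- by move=> k; rewrite /A2; case: ifP.
- have far (j k : nat) : (j < N)%N -> (k < N')%N ->
    (sigma j).1 != (sigma k).1 + n%:Z.
    move=> jN kN'.
    have := leq_bigmax (F := fun j : 'I_N => `|(sigma j).1|%N) (Ordinal jN).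
    have := leq_bigmax (F := fun j : 'I_N' => `|(sigma j).1|%N) (Ordinal kN').
    move=> /= + +; move: bn; rewrite /b.
    move: (\max_(i < N) _)%N (\max_(i < N') _)%N (sigma j).1 (sigma k).1.
    by move=> u v x y; lia.
  move=> j k; rewrite !inE /tau => jN kN.
  case: ltnP => jN1; case: ltnP => kN1.
  - exact: sigma_inj.
  - have kN' : (k - N < N')%N by rewrite ltn_subLR.
    have := far _ _ jN1 kN'; case: (sigma j) => ? ? /= /eqP + [e _].
    by rewrite e.
  - have jN' : (j - N < N')%N by rewrite ltn_subLR.
    have := far _ _ kN1 jN'; case: (sigma k) => ? ? /= /eqP + [e _].
    by rewrite e.
  - move=> [] /addIr e1 e2.
    have : sigma (j - N)%N = sigma (k - N)%N.
      by move: e1 e2; case: (sigma (j - N)%N) (sigma (k - N)%N) => ? ? [? ?] /= -> ->.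
    by move=> /sigma_inj; lia.
rewrite big_split_ord /= CE CE' !nu_iid //.
congr (_ * _)%E; apply: eq_bigr => k _; rewrite /A2; first by rewrite ltn_ord.
by rewrite ltnNN addKn.
Qed.


Let p (D : set (env R * env R)) : R := fine (m D).

Let p_ge0 D : 0 <= p D. Proof. exact: fine_ge0. Qed.

Let pE D : measurable D -> m D = (p D)%:E.
Proof. by move=> mD; rewrite /p fineK // fin_num_measure. Qed.

Let p_add D D' : measurable D -> measurable D' -> D `&` D' = set0 ->
  p (D `|` D') = p D + p D'.
Proof.
move=> mD mD' DD'.
have : m (D `|` D') = (m D + m D')%E by exact: measureU.
rewrite !pE //; last exact: measurableU.
by move=> -[].
Qed.

Let p_le D D' : measurable D -> measurable D' -> D `<=` D' -> p D <= p D'.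
Proof.
move=> mD mD' DD'; rewrite -lee_fin -!pE //.
by apply: le_measure => //; rewrite inE.
Qed.

Let p_rectangle B C : measurable B -> measurable C ->
  p (B `*` C) = fine (mu B) * fine (nu C).
Proof.
move=> mB mC; rewrite /p m_rectangle //.
by rewrite fineM // fin_num_measure.
Qed.

Let Tinv n (D : set (env R * env R)) := iter n (@pair_shift R) @^-1` D.

Let measurable_Tinv n D : measurable D -> measurable (Tinv n D).
Proof.
move=> mD; apply: measurable_preimageT mD; apply: measurable_iter.
exact: measurable_pair_shift.
Qed.

Let p_Tinv n D : measurable D -> p (Tinv n D) = p D.
Proof. by move=> mD; rewrite /p pair_shift_measure. Qed.

(** * Asymptotic independence under the shift *)

Section Mixing.
Variables (B C : set (env R)).
Hypotheses (mB : measurable B) (sC : cylinders sigma C).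

Let mC : measurable C.
Proof. by case: sC => N [A [mA ->]]; exact: measurable_cylinder. Qed.

(** Defect of independence between [C] and the shifted event when the first coordinate is restricted
    to [B]. *)
Let gap n D : R :=
  p ((B `*` C) `&` Tinv n D) - fine (nu C) * p ((B `*` setT) `&` Tinv n D).

Let mR : measurable (B `*` C). Proof. exact: measurableX. Qed.
Let mRT : measurable (B `*` [set: env R]). Proof. exact: measurableX. Qed.

Let gap_add n D D' : measurable D -> measurable D' -> D `&` D' = set0 ->
  gap n (D `|` D') = gap n D + gap n D'.
Proof.
move=> mD mD' DD'.
have mI Y Z : measurable Y -> measurable Z -> measurable (Y `&` Tinv n Z).
  by move=> mY mZ; apply: measurableI => //; exact: measurable_Tinv.
have split Y : measurable Y ->
    p (Y `&` Tinv n (D `|` D')) = p (Y `&` Tinv n D) + p (Y `&` Tinv n D').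
  move=> mY; rewrite -p_add; [|exact: mI|exact: mI|].
    by rewrite -setIUr /Tinv preimage_setU.
  apply/seteqP; split=> // z [[_ Dz] [_ D'z]].
  by have : (D `&` D') (iter n (@pair_shift R) z) by []; rewrite DD'.
by rewrite /gap !split //; lra.
Qed.

(** Invariance of [m] makes the bound uniform in [n], so that small events can be neglected. *)
Let gap_bound n D : measurable D -> `|gap n D| <= p D.
Proof.
move=> mD; rewrite /gap.
have sub Y : measurable Y -> p (Y `&` Tinv n D) <= p D.
  move=> mY; rewrite -(p_Tinv n mD); apply: p_le; last exact: subIsetr.
    by apply: measurableI => //; exact: measurable_Tinv.
  exact: measurable_Tinv.
have := sub _ mR; have := sub _ mRT.
have := p_ge0 ((B `*` C) `&` Tinv n D).
have := p_ge0 ((B `*` setT) `&` Tinv n D).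
have : 0 <= fine (nu C) <= 1.
  rewrite fine_ge0 //= -lee_fin fineK ?fin_num_measure //.
  exact: probability_le1.
move: (fine _) (p _) (p _) (p _) => c x y z c01 x0 y0 xz yz.
rewrite ler_norml; apply/andP; split; nra.
Qed.

Let gap_setT n : gap n setT = 0.
Proof.
rewrite /gap /Tinv preimage_setT !setIT !p_rectangle //.
by rewrite probability_setT /=; lra.
Qed.

(** For a rectangle the gap is zero as soon as the windows separate. Additivity and the uniform
    bound make the events with vanishing gap a Dynkin class. *)
Lemma mixing D : measurable D ->
  forall e, 0 < e -> exists n0, forall n, (n0 <= n)%N -> `|gap n D| <= e.
Proof.
pose P (D : set (env R * env R)) := forall e, 0 < e ->
  exists n0, forall n, (n0 <= n)%N -> `|gap n D| <= e.
rewrite (measurable_rectangles (env R) sigma_surj).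
have PU D1 D2 : measurable D1 -> measurable D2 -> D1 `&` D2 = set0 ->
    P D1 -> P D2 -> P (D1 `|` D2).
  move=> mD1 mD2 D12 P1 P2 e e0.
  have [n1 h1] := P1 (e / 2) ltac:(lra).
  have [n2 h2] := P2 (e / 2) ltac:(lra).
  exists (maxn n1 n2) => n; rewrite geq_max => /andP[/h1 {}h1 /h2 {}h2].
  by rewrite gap_add //; apply: le_trans (ler_normD _ _) _; lra.
apply: (dynkin_induction (G := rectangles sigma) (P := P)).
- exact: measurable_rectangles.
- exact: rectangles_setI.
- by move=> e e0; exists 0%N => n _; rewrite gap_setT normr0 ltW.
- move=> _ [B' [C' [mB' sC' ->]]] e e0.
  have [n0 hn0] := cylinders_shift_indep sC sC'.
  exists n0 => n nn0.
  have mC' : measurable C'.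
    by case: sC' => N [A [mA ->]]; exact: measurable_cylinder.
  have mS (Y : set (env R)) : measurable Y ->
      measurable (iter n (@Defs.shift R) @^-1` Y).
    move=> mY; apply: measurable_preimageT mY; apply: measurable_iter.
    exact: measurable_shift.
  have TX : Tinv n (B' `*` C') = (iter n (@Defs.shift R) @^-1` B') `*`
      (iter n (@Defs.shift R) @^-1` C').
    by apply/funext => z; rewrite /Tinv /preimage /= iter_pair_shift.
  have mBB : measurable (B `&` iter n (@Defs.shift R) @^-1` B').
    by apply: measurableI => //; exact: mS.
  rewrite /gap TX -!setXI setTI p_rectangle //; last first.
    by apply: measurableI => //; exact: mS.
  rewrite p_rectangle //; last exact: mS.
  rewrite hn0 // shift_cylinder_measure // fineM ?fin_num_measure //.
  by rewrite mulrCA subrr normr0 ltW.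
- move=> D1 mD1 PD1 e e0.
  have [n0 hn0] := PD1 e e0; exists n0 => n /hn0.
  have := gap_setT n; rewrite -(setUv D1) gap_add //.
  + by move/eqP; rewrite addr_eq0 => /eqP ->; rewrite normrN.
  + exact: measurableC.
  + by rewrite setICr.
- move=> F mF tF PF e e0.
  (* Finite unions are handled by additivity; the tail [G N] has small measure by continuity from
     above, hence a small gap for every [n]. *)
  pose H N := \big[setU/set0]_(k < N) F k.
  pose G N := (\bigcup_k F k) `\` H N.
  have mU : measurable (\bigcup_k F k) by exact: bigcupT_measurable.
  have mH N : measurable (H N) by exact: bigsetU_measurable.
  have mG N : measurable (G N) by exact: measurableD.
  have PH N : P (H N).
    rewrite /H; elim: N => [|N IH].
      rewrite big_ord0 => e' e'0; exists 0%N => n _.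
      apply: le_trans (gap_bound _ _) _ => //.
      by rewrite /p measure0 ltW.
    rewrite big_ord_recr /=; apply: PU => //; first exact: mH.
    apply/seteqP; split=> // z [+ Fz]; rewrite -bigcup_mkord => -[k /= kN Fkz].
    have := tF _ _ Logic.I Logic.I (ex_intro _ z (conj Fkz Fz)).
    by move: kN => /[swap] ->; rewrite ltnn.
  have [N GN] : exists N, p (G N) <= e / 2.
    have G0 : \bigcap_N G N = set0.
      apply/seteqP; split=> // z /= hz.
      have [[k _ Fkz] _] := hz 0%N Logic.I.
      have [_] := hz k.+1 Logic.I; apply.
      by rewrite /H big_ord_recr /=; right.
    have cG : (m \o G) x @[x --> \oo] --> m (\bigcap_N G N).
      apply: nonincreasing_cvg_mu => //.
      - by apply: le_lt_trans (ltry 1); exact: probability_le1.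
      - by rewrite G0.
      - move=> i j ij; apply/subsetPset; apply: setDS.
        exact: subset_bigsetU.
    move: cG; rewrite G0 measure0 => /fine_cvgP[_ /cvgrPdist_le].
    move=> /(_ (e / 2) ltac:(lra)) [N _ /(_ N (leqnn N))] /=.
    by rewrite sub0r normrN => hN; exists N; exact: le_trans (ler_norm _) hN.
  have [n0 hn0] := PH N (e / 2) ltac:(lra).
  exists n0 => n /hn0 h.
  have -> : \bigcup_k F k = H N `|` G N.
    rewrite /G setDE setUIr setUv setIT; apply/esym/setUidr.
    exact: bigsetU_bigcup.
  rewrite gap_add //; last by rewrite /G setDE setICA setICr setI0.
  have gG := gap_bound n (mG N).
  by apply: le_trans (ler_normD _ _) _; lra.
Qed.

End Mixing.

(** The preimages of [E] contain [E] and have the same measure, so they differ from it by null sets.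
    The gap of [E] is therefore constant in [n], and by [mixing] it is 0. *)
Lemma invariant_rectangle E B C : measurable E -> E `<=` @pair_shift R @^-1` E ->
  measurable B -> cylinders sigma C ->
  m ((B `*` C) `&` E) = (m ((B `*` setT) `&` E) * nu C)%E.
Proof.
move=> mE ET mB sC.
have mC : measurable C by case: sC => N [A [mA ->]]; exact: measurable_cylinder.
have EI n : E `<=` Tinv n E.
  elim: n => [//|n IH] z /IH Ez; rewrite /Tinv /preimage /=.
  exact: ET.
have pI n Y : measurable Y -> p (Y `&` Tinv n E) = p (Y `&` E).
  move=> mY.
  have mTE : measurable (Tinv n E) by exact: measurable_Tinv.
  have mD : measurable (Tinv n E `\` E) by exact: measurableD.
  have ED : E `|` (Tinv n E `\` E) = Tinv n E by exact: setDUK.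
  have := p_Tinv n mE; rewrite -ED p_add //; last by rewrite setDE setICA setICr setI0.
  have YD : measurable (Y `&` (Tinv n E `\` E)) by exact: measurableI.
  have YE : measurable (Y `&` E) by exact: measurableI.
  rewrite setIUr p_add //; last first.
    by apply/seteqP; split=> // z [[_ Ez] [_ []]].
  have := p_le YD mD (@subIsetr _ _ _); have := p_ge0 (Y `&` (Tinv n E `\` E)).
  by lra.
have mR : measurable (B `*` C) by exact: measurableX.
have mRT : measurable (B `*` [set: env R]) by exact: measurableX.
rewrite !pE; try exact: measurableI; try exact: mC.
rewrite -[nu C]fineK ?fin_num_measure // -EFinM; congr EFin.
apply/eqP; rewrite mulrC -subr_eq0 -normr_le0; apply/ler_addgt0Pl => e e0.
have [n0 /(_ n0 (leqnn _))] := mixing mB sC mE e0.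
by rewrite !pI // addr0.
Qed.

Lemma monotone_event_01 E : measurable E -> E `<=` @pair_shift R @^-1` E ->
  m E = 0%E \/ m E = 1%E.
Proof.
move=> mE ET.
(* [k] is the first marginal of [m] restricted to [E]; by [invariant_rectangle] this restriction is
   the product of [k] and [nu]. *)
have [k kE] := exists_pushforward_measure (mrestr m mE)
  (@measurable_fst _ _ (env R) (env R)).
have kB B : k B = m ((B `*` setT) `&` E).
  by rewrite kE /mrestr setXT.
have kprod D : measurable D -> m (D `&` E) = (k \x nu)%E D.
  move=> mD.
  transitivity (mrestr m mE D) => //.
  apply: (rectangle_measure_unique (sigma := sigma)) mD => //.
    by rewrite /mrestr; apply: le_lt_trans (ltry 1); apply: probability_le1;
      exact: measurableI.
  move=> B C mB sC.
  have mC : measurable C by case: sC => N [A [mA ->]]; exact: measurable_cylinder.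
  transitivity (k B * nu C)%E; last by apply/esym; exact: product_measure1E.
  by rewrite kB; exact: invariant_rectangle.
have mEc : measurable (~` E) by exact: measurableC.
pose f (w : env R) : \bar R := nu (xsection (~` E) w).
have mf : measurable_fun setT f by exact: measurable_fun_xsection.
have f_ge0 w : (0 <= f w)%E by exact: measure_ge0.
pose G : set (env R) := [set w | f w = 0%E].
have GcE : ~` G = setT `&` [set w | f w != 0%E].
  by apply/seteqP; split=> w /=; [move=> /eqP|move=> [_ /eqP]].
have mGc : measurable (~` G) by rewrite GcE; exact: emeasurable_neq.
have mG : measurable G by rewrite -(setCK G); exact: measurableC.
(* The product formula at the complement of [E] says that [f] has integral 0 against [k]. *)
have kG : k (~` G) = 0%E.
  have : (\int[k]_x `|f x|)%E = 0%E.
    have := kprod _ mEc; rewrite setICl measure0 => ->.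
    by apply: eq_integral => w _; rewrite gee0_abs.
  move=> /(ae_eq_integral_abs _ measurableT mf) f0.
  apply/negligibleP => //; apply: negligibleS f0 => w /= Gw /(_ Logic.I).
  exact: Gw.
(* [E] and the cylinder over [G] differ by a null set: off [G] because [k] vanishes there, over [G]
   because [f] does. *)
have mGE : m E = mu G.
  have mGT : measurable (G `*` [set: env R]) by exact: measurableX.
  have -> : mu G = m (G `*` setT).
    by rewrite m_rectangle // probability_setT mule1.
  have e1 : m E = (m (E `\` (G `*` setT)) + m (E `&` (G `*` setT)))%E.
    exact: measureDI.
  have e2 : m (G `*` setT) = (m ((G `*` setT) `\` E) + m ((G `*` setT) `&` E))%E.
    exact: measureDI.
  rewrite e1 e2 setIC; congr (_ + _)%E.
  transitivity (0%E : \bar R).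
    rewrite -kG kB; congr (m _); apply/seteqP; split=> -[w v] /=.
      by move=> [Ez nG]; split=> //; split=> // Gw; apply: nG.
    by move=> [[nG _] Ez]; split=> // -[].
  apply/esym; transitivity ((mu \x nu)%E ((G `*` setT) `\` E)) => //.
  rewrite /product_measure1 integral0_eq // => w _ /=.
  have [Gw|nGw] := pselect (G w).
    rewrite -[RHS]Gw /f; congr (nu _); apply/seteqP; split=> v.
      by move=> /xsectionP [_ nE]; apply/xsectionP.
    by move=> /xsectionP nE; apply/xsectionP.
  rewrite (_ : xsection _ _ = set0) ?measure0 //.
  by apply/seteqP; split=> // v /xsectionP [[]].
(* The section of the complement of [E] at the shifted [w] pulls back into the section at [w], and
   the shift preserves [nu]. *)
have GT : G `<=` @Defs.shift R @^-1` G.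
  move=> w; rewrite /G /= => Gw.
  have mx w' : measurable (xsection (~` E) w') by exact: measurable_xsection.
  rewrite /f -shift_measure //; apply: (subset_measure0 _ _ _ Gw) => //.
    exact: measurable_preimageT (@measurable_shift R) _.
  move=> v /xsectionP /= nE; apply/xsectionP => /= /ET; exact: nE.
rewrite mGE.
(* [ergodic] asks for exact invariance: the increasing union of the preimages of [G] has it, and has
   the measure of [G]. *)
pose F n := iter n (@Defs.shift R) @^-1` G.
have mF n : measurable (F n).
  apply: measurable_preimageT mG; apply: measurable_iter.
  exact: measurable_shift.
have mUF : measurable (\bigcup_n F n) by exact: bigcupT_measurable.
have FS n : F n `<=` F n.+1 by move=> w /GT.
have muF n : mu (F n) = mu G.
  elim: n => [//|n IH]; rewrite -IH -(mu_stat (mF n)).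
  by congr (mu _); apply/funext => w; rewrite /F /preimage /= -iterS iterSr.
have <- : mu (\bigcup_n F n) = mu G.
  have : (mu \o F) x @[x --> \oo] --> mu (\bigcup_n F n).
    apply: nondecreasing_cvg_mu => //.
    by apply/nondecreasing_seqP => n; apply/subsetPset; exact: FS.
  move=> /cvg_lim <- //; rewrite (_ : mu \o F = cst (mu G)); last first.
    by apply/funext => n; exact: muF.
  exact: lim_cst.
apply: mu_erg => //; apply/seteqP; split=> w.
  by move=> [n _ h]; exists n.+1 => //; rewrite /F /preimage /= -iterS iterSr.
by move=> [n _ /FS h]; exists n => //; move: h; rewrite /F /preimage /= -iterS iterSr.
Qed.

Lemma antitone_event_01 E : measurable E -> @pair_shift R @^-1` E `<=` E ->
  m E = 0%E \/ m E = 1%E.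
Proof.
move=> mE TE; have mEc : measurable (~` E) by exact: measurableC.
have pC : p E + p (~` E) = 1.
  rewrite -p_add ?setICr // setUv -setXTT p_rectangle //.
  by rewrite !probability_setT mulr1.
have [|h|h] := monotone_event_01 mEc; first by move=> z nEz /TE.
  by right; rewrite pE //; congr EFin; move: pC; rewrite {2}/p h /= addr0.
by left; rewrite pE //; congr EFin; move: pC; rewrite {2}/p h /=; lra.
Qed.

End ErgodicProduct.

(** * Law of the trajectory *)

Lemma eq_measure_bigcap (R : realType) d (T : measurableType d)
  (m : probability T R) (F G : (set T)^nat) :
  (forall n, measurable (F n)) -> (forall n, measurable (G n)) ->
  nonincreasing_seq F -> nonincreasing_seq G ->
  (forall n, m (F n) = m (G n)) -> m (\bigcap_n F n) = m (\bigcap_n G n).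
Proof.
move=> mF mG ndF ndG FG.
have cvg (H : (set T)^nat) : (forall n, measurable (H n)) ->
    nonincreasing_seq H -> (m \o H) x @[x --> \oo] --> m (\bigcap_n H n).
  move=> mH ndH; apply: nonincreasing_cvg_mu => //.
    by apply: le_lt_trans (ltry 1); exact: probability_le1.
  exact: bigcapT_measurable.
have FG' : m \o F = m \o G by apply/funext => n; exact: FG.
have := cvg _ mF ndF; rewrite FG' => /cvg_lim <- //.
by apply/cvg_lim => //; exact: cvg.
Qed.

Lemma eq_measure_bigcup (R : realType) d (T : measurableType d)
  (m : {measure set T -> \bar R}) (F G : (set T)^nat) :
  (forall n, measurable (F n)) -> (forall n, measurable (G n)) ->
  nondecreasing_seq F -> nondecreasing_seq G ->
  (forall n, m (F n) = m (G n)) -> m (\bigcup_n F n) = m (\bigcup_n G n).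
Proof.
move=> mF mG ndF ndG FG.
have cvg (H : (set T)^nat) : (forall n, measurable (H n)) ->
    nondecreasing_seq H -> (m \o H) x @[x --> \oo] --> m (\bigcup_n H n).
  by move=> mH ndH; apply: nondecreasing_cvg_mu => //; exact: bigcupT_measurable.
have FG' : m \o F = m \o G by apply/funext => n; exact: FG.
have := cvg _ mF ndF; rewrite FG' => /cvg_lim <- //.
by apply/cvg_lim => //; exact: cvg.
Qed.

Section PathLaw.
Context {R : realType} (mu nu : probability (env R) R).
Variable sigma : nat -> int * nat.
Hypothesis sigma_surj : forall i, exists k, sigma k = i.
Hypothesis nu_iid : iid nu sigma.

Let m : probability (env R * env R)%type R := (mu \x nu)%E.

(* Reads the uniform variable [tau k i] at the step made at time [k] with the
   cookie [i]: [tau k i = i] gives the stack walk, while [tau k i = sigma k]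
   gives a walk reading the uniform variables in chronological order. *)
Definition traj (tau : nat -> int * nat -> int * nat) (z : env R * env R) n :=
  walk_traj (fun k i => z.2 (tau k i) < z.1 i) 0 n.

(** The condition that makes the variables read along a fixed path i.i.d. uniform. *)
Definition fresh (tau : nat -> int * nat -> int * nat) :=
  forall g, {in [pred k | (k < size g)%N] &,
    injective (fun k => tau k (visit g k))}.

Definition hop_set (c : R) (y y' : int) : set R :=
  [set u | y' = hop (u < c) y].

Lemma measurable_hop_set c y y' : measurable (hop_set c y y').
Proof.
rewrite (_ : hop_set c y y' = (fun u => u < c) @^-1` [set b | y' = hop b y]) //.
by apply: measurable_preimageT => //; apply: measurable_fun_ltr.
Qed.

Lemma measurable_traj_eq tau n g : measurable [set z | traj tau z n = g].
Proof.
have [gV|gV] := pselect (size g = n.+1 /\ nth 0 g 0 = 0); last first.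
  rewrite (_ : [set z | _] = set0) //.
  by apply/seteqP; split=> // z /walk_trajP[sg g0 _]; apply: gV.
rewrite (_ : [set z | _] = \bigcap_(k < n)
   ((fun z : env R * env R => z.2 (tau k (visit g k)) < z.1 (visit g k)) @^-1`
     [set b | nth 0 g k.+1 = hop b (nth 0 g k)])); last first.
  apply/seteqP; split=> z /=.
    by move=> /walk_trajP[_ _ h] k /= kn; exact: h.
  by move=> h; apply/walk_trajP; case: gV => sg g0; split=> // k kn; exact: h.
apply: bigcap_measurableType => k _; apply: measurable_preimageT => //.
apply: measurable_fun_ltr.
  exact: measurableT_comp (measurable_env_coord _) measurable_snd.
exact: measurableT_comp (measurable_env_coord _) measurable_fst.
Qed.

(** Given [w], the probability of following [g] is the product of its step probabilities, whichever
    distinct uniform variables are read. *)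
Lemma traj_eq_measure tau tau' n g : fresh tau -> fresh tau' ->
  m [set z | traj tau z n = g] = m [set z | traj tau' z n = g].
Proof.
have [gV|gV] := pselect (size g = n.+1 /\ nth 0 g 0 = 0); last first.
  have E0 t : [set z | traj t z n = g] = set0.
    by apply/seteqP; split=> // z /walk_trajP[sg g0 _]; apply: gV.
  by rewrite !E0.
case: gV => sg g0.
pose A (w : env R) k := hop_set (w (visit g k)) (nth 0 g k) (nth 0 g k.+1).
suff E t : fresh t -> m [set z | traj t z n = g] =
    (\int[mu]_w \prod_(k < n) unif01 (A w k))%E.
  by move=> ft ft'; rewrite !E.
move=> ft; apply: eq_integral => w _ /=.
rewrite (_ : xsection _ w = cylinder (fun k => t k (visit g k)) n (A w)).
  apply: (iid_injective sigma_surj) => //.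
    move=> j k jn kn; apply: (ft g); rewrite inE sg; exact: ltnW.
  by move=> k; exact: measurable_hop_set.
apply/seteqP; split=> v.
  by move=> /xsectionP /walk_trajP[_ _ h] k kn; exact: h.
by move=> h; apply/xsectionP/walk_trajP; split=> // k kn; exact: h.
Qed.

(** Paths are countable: coding them by [pickle] cuts the event into countably many pieces, each
    empty or given by a single path. *)
Lemma traj_setE tau n (Q : set (seq int)) : [set z | Q (traj tau z n)] =
  \bigcup_i [set z | pickle (traj tau z n) = i /\ Q (traj tau z n)].
Proof.
apply/seteqP; split=> z /=; last by move=> [i _ []].
by move=> Qz; exists (pickle (traj tau z n)).
Qed.

Lemma traj_fiberE tau n (Q : set (seq int)) i :
  [set z | pickle (traj tau z n) = i /\ Q (traj tau z n)] =
  if pselect (exists g, pickle g = i /\ Q g) is left h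
  then [set z | traj tau z n = sval (cid h)] else set0.
Proof.
case: pselect => [h|h]; last first.
  by apply/seteqP; split=> // z [zi Qz]; apply: h; exists (traj tau z n).
case: (cid h) => g [gi Qg] /=; apply/seteqP; split=> z /=.
  by move=> [zi _]; apply: (pcan_inj pickleK); rewrite zi.
by move=> ->.
Qed.

Lemma measurable_traj_fiber tau n (Q : set (seq int)) i :
  measurable [set z | pickle (traj tau z n) = i /\ Q (traj tau z n)].
Proof.
by rewrite traj_fiberE; case: pselect => // h; exact: measurable_traj_eq.
Qed.

Lemma measurable_traj_set tau n (Q : set (seq int)) :
  measurable [set z | Q (traj tau z n)].
Proof.
by rewrite traj_setE; apply: bigcupT_measurable => i; exact: measurable_traj_fiber.
Qed.

Lemma traj_set_measure tau tau' n (Q : set (seq int)) :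
  fresh tau -> fresh tau' ->
  m [set z | Q (traj tau z n)] = m [set z | Q (traj tau' z n)].
Proof.
move=> ft ft'.
have E t : m [set z | Q (traj t z n)] = (\sum_(i <oo)
    m [set z | pickle (traj t z n) = i /\ Q (traj t z n)])%E.
  rewrite traj_setE; apply: measure_semi_bigcup => [i||].
  - exact: measurable_traj_fiber.
  - by move=> i j _ _ [z [[<- _] [<- _]]].
  - by apply: bigcupT_measurable => i; exact: measurable_traj_fiber.
rewrite !E; apply: eq_eseriesr => i _; rewrite !traj_fiberE.
by case: pselect => // h; exact: traj_eq_measure.
Qed.

(** * Events at infinity *)

Section Eventually.
Variable Phi : nat -> int -> Prop.
Hypothesis Phi_antitone : forall M x, Phi M.+1 x -> Phi M x.

Definition walk_eventually tau : set (env R * env R) :=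
  [set z | forall M, exists N, forall n, (N <= n)%N ->
     Phi M (last 0 (traj tau z n))].

Let window tau M N K : set (env R * env R) :=
  [set z | forall n, (N <= n <= K)%N -> Phi M (last 0 (traj tau z n))].

(** Reading every time off the single path up to [K] makes the window an event of a finite
    trajectory. *)
Let in_window M N K : set (seq int) :=
  [set g | forall n, (N <= n <= K)%N -> Phi M (nth 0 g n)].

Let windowE tau M N K :
  window tau M N K = [set z | in_window M N K (traj tau z K)].
Proof.
apply/seteqP; split=> z /= h n nN; have := h n nN; rewrite nth_walk_traj //.
- by case/andP: nN.
- by case/andP: nN.
Qed.

Let eventuallyE tau : walk_eventually tau =
  \bigcap_M \bigcup_N \bigcap_K window tau M N K.
Proof.
apply/seteqP; split=> z /=.
  move=> h M _; have [N hN] := h M; exists N => // K _ n /andP[Nn _].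
  exact: hN.
move=> h M; have [N _ hN] := h M Logic.I; exists N => n Nn.
by apply: (hN n Logic.I); rewrite Nn leqnn.
Qed.

Let m1 tau M N K : measurable (window tau M N K).
Proof. by rewrite windowE; exact: measurable_traj_set. Qed.

Let m2 tau M N : measurable (\bigcap_K window tau M N K).
Proof. by apply: bigcapT_measurable => K; exact: m1. Qed.

Let m3 tau M : measurable (\bigcup_N \bigcap_K window tau M N K).
Proof. by apply: bigcupT_measurable => N; exact: m2. Qed.

Lemma measurable_walk_eventually tau : measurable (walk_eventually tau).
Proof. by rewrite eventuallyE; apply: bigcapT_measurable => M; exact: m3. Qed.

(** Finite windows have equal measures, and the limits in [K], [N] and [M] are all monotone, the
    last one by [Phi_antitone]. *)
Lemma walk_eventually_measure tau tau' : fresh tau -> fresh tau' ->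
  m (walk_eventually tau) = m (walk_eventually tau').
Proof.
move=> ft ft'; rewrite !eventuallyE.
have d3 t : nonincreasing_seq (fun M => \bigcup_N \bigcap_K window t M N K).
  apply/nonincreasing_seqP => M; apply/subsetPset => z [N _ h].
  by exists N => // K _ n Nn; apply: Phi_antitone; exact: h Nn.
have d2 t M : nondecreasing_seq (fun N => \bigcap_K window t M N K).
  apply/nondecreasing_seqP => N; apply/subsetPset => z h K _ n /andP[Nn nK].
  by apply: (h K Logic.I); rewrite ltnW.
have d1 t M N : nonincreasing_seq (window t M N).
  apply/nonincreasing_seqP => K; apply/subsetPset => z h n /andP[Nn nK].
  by apply: h; rewrite Nn ltnW.
apply: eq_measure_bigcap => // M; apply: eq_measure_bigcup => // N.
apply: eq_measure_bigcap => // K; rewrite !windowE.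
exact: traj_set_measure.
Qed.

End Eventually.

End PathLaw.

(** * Coupling with the stack walk *)

Lemma erw_trajE (R : realType) (w : env R) (u : nat -> R) x n :
  erw_traj w u x n = walk_traj (fun k i => u k < w i) x n.
Proof.
elim: n => [//|n IH] /=; rewrite IH.
by congr rcons.
Qed.

Lemma exists_enumeration : exists (sigma : nat -> int * nat) rk,
  cancel rk sigma /\ cancel sigma rk.
Proof.
have /card_set_bijP[rk [_ rk_inj rk_surj]] : ([set: int * nat] #= [set: nat])%card.
  apply: eq_card_nat => //; apply/infiniteP.
  rewrite (_ : [set: nat] = snd @` [set: int * nat]); first exact: card_image_le.
  by apply/seteqP; split=> // n _; exists (0, n).
have /choice[sigma sigmaK] : forall k, exists i, rk i = k.
  by move=> k; have [i _ <-] := rk_surj k Logic.I; exists i.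
exists sigma, rk; split=> // i.
by apply: rk_inj; rewrite ?inE // sigmaK.
Qed.

Section Coupling.
Context {R : realType} (mu : probability (env R) R) d (S : measurableType d)
  (P : probability S R) (W : S -> env R) (U : nat -> S -> R).
Hypothesis WU : annealed_coupling P mu W U.
Variables (sigma : nat -> int * nat) (rk : int * nat -> nat).
Hypotheses (rkK : cancel rk sigma) (sigmaK : cancel sigma rk).

(** The variable of time [k] is stored at the cookie [sigma k], so a walk reading [sigma k] at time
    [k] is the excited walk driven by [U]. *)
Definition site_uniforms (s : S) : env R := fun i => U (rk i) s.

Let mV : measurable_fun setT site_uniforms.
Proof. by apply: measurable_env_fun => i; have [_ [mU _]] := WU; exact: mU. Qed.

Let sigma_surj i : exists k, sigma k = i.
Proof. by exists (rk i); rewrite rkK. Qed.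

Lemma coupling_cylinder N (A : nat -> set R) B :
  measurable B -> (forall k, measurable (A k)) ->
  P [set s | B (W s) /\ cylinder sigma N A (site_uniforms s)] =
  (mu B * \prod_(k < N) unif01 (A k))%E.
Proof.
move=> mB mA; have [_ [_ <- //]] := WU; congr (P _); apply/seteqP.
by split=> s /= [Bs h]; split=> // k kN; have := h k kN;
  rewrite /site_uniforms sigmaK.
Qed.

Lemma exists_uniform_law : exists nu : probability (env R) R,
  iid nu sigma /\
  forall D, measurable D -> P [set s | D (W s, site_uniforms s)] = (mu \x nu)%E D.
Proof.
pose V : {mfun S >-> env R} :=
  HB.pack site_uniforms (isMeasurableFun.Build _ _ _ _ site_uniforms mV).
pose nu : probability (env R) R := distribution P V.
have nuE A : nu A = P (site_uniforms @^-1` A) by [].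
have nu_iid : iid nu sigma.
  move=> N A mA; rewrite nuE.
  have := coupling_cylinder N measurableT mA; rewrite probability_setT mul1e => <-.
  by congr (P _); apply/seteqP; split=> s //= [].
exists nu; split=> // D mD.
have mWV : measurable_fun setT (fun s => (W s, site_uniforms s)).
  by apply: measurable_fun_pair; [case: WU|exact: mV].
have [p pE] := exists_pushforward_measure P mWV.
rewrite -[LHS]pE.
apply: (rectangle_measure_unique (sigma := sigma)) mD => //.
  by rewrite pE preimage_setT; apply: le_lt_trans (ltry 1); exact: probability_le1.
move=> B _ mB [N [A [mA ->]]].
transitivity (mu B * nu (cylinder sigma N A))%E.
  by rewrite pE nu_iid // -coupling_cylinder.
by apply/esym; apply: product_measure1E => //; exact: measurable_cylinder.
Qed.

Lemma fresh_site : fresh (fun _ i => i).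
Proof. exact: visit_inj. Qed.

Lemma fresh_time : fresh (fun k _ => sigma k).
Proof. by move=> g j k _ _; exact: (can_inj sigmaK). Qed.

Definition arrows (z : env R * env R) (i : int * nat) : bool := z.2 i < z.1 i.

Lemma last_traj_site (z : env R * env R) n :
  last 0 (traj (fun _ i => i) z n) = pos (arrows z) 0 n.
Proof. exact: last_walk_traj. Qed.

Lemma last_traj_time s n :
  last 0 (traj (fun k _ => sigma k) (W s, site_uniforms s) n) =
  erw (W s) (fun k => U k s) 0 n.
Proof.
rewrite /erw erw_trajE /traj /site_uniforms /=.
by under eq_fun do rewrite sigmaK.
Qed.

(** Passage from the excited walk to the stack walk: reading by time and reading by site are both
    fresh, so they give the event the same probability. *)
Lemma eventually_erw_measure (Phi : nat -> int -> Prop) :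
  (forall M x, Phi M.+1 x -> Phi M x) ->
  exists nu : probability (env R) R, iid nu sigma /\
  P [set s | forall M, exists N, forall n, (N <= n)%N ->
       Phi M (erw (W s) (fun k => U k s) 0 n)] =
  (mu \x nu)%E (walk_eventually Phi (fun _ i => i)).
Proof.
move=> PhiS; have [nu [nu_iid PE]] := exists_uniform_law.
exists nu; split=> //.
transitivity ((mu \x nu)%E (walk_eventually Phi (fun k _ => sigma k))); last first.
  exact: (walk_eventually_measure mu sigma_surj nu_iid PhiS fresh_time fresh_site).
rewrite -PE; last exact: measurable_walk_eventually.
congr (P _); apply/seteqP; split=> s h M; have [N hN] := h M; exists N => n Nn;
  by have := hN n Nn; rewrite last_traj_time.
Qed.

End Coupling.

(** * Zero-one laws for escape to either side *)

Lemma goes_right_pair_shift (R : realType) (z : env R * env R) :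
  goes_right (arrows z) 0 -> goes_right (arrows (pair_shift z)) 0.
Proof.
(* The walk from 0 in the shifted arrows is the walk from 1 translated by -1, hence the level
   [M + 1]. *)
move=> /goes_right_succ h M; have [N hN] := h (M + 1); exists N => n /hN.
by have := pos_shift (arrows z) 0 n; rewrite add0r => ->; rewrite lerD2r.
Qed.

Lemma goes_left_pair_shift (R : realType) (z : env R * env R) :
  goes_left (arrows (pair_shift z)) 0 -> goes_left (arrows z) 0.
Proof.
move=> h; apply: goes_left_pred => M; have [N hN] := h (M - 1).
exists N => n /hN.
by have := pos_shift (arrows z) 0 n; rewrite add0r => ->; rewrite lerBrDr.
Qed.

(** Natural levels turn escape into the countable intersection used by [walk_eventually]. *)
Lemma ge_natP (X : nat -> int) :
  (forall M : int, exists N, forall n, (N <= n)%N -> M <= X n) <->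
  (forall M : nat, exists N, forall n, (N <= n)%N -> M%:Z <= X n).
Proof.
split=> [h M|h M]; first exact: h.
have [N hN] := h `|M|%N; exists N => n /hN; apply: le_trans.
by rewrite abszE ler_norm.
Qed.

Lemma le_natP (X : nat -> int) :
  (forall M : int, exists N, forall n, (N <= n)%N -> X n <= M) <->
  (forall M : nat, exists N, forall n, (N <= n)%N -> X n <= - M%:Z).
Proof.
split=> [h M|h M]; first exact: h.
have [N hN] := h `|M|%N; exists N => n /hN /le_trans; apply.
by rewrite abszE lerNl -normrN ler_norm.
Qed.

Lemma walk_eventually_goes_right (R : realType) :
  walk_eventually (fun M x => M%:Z <= x) (fun _ i => i) =
  [set z : env R * env R | goes_right (arrows z) 0].
Proof.
apply/seteqP; split=> z /=.
  move=> h; apply/ge_natP => M; have [N hN] := h M.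
  by exists N => n /hN; rewrite last_traj_site.
move=> /ge_natP h M; have [N hN] := h M.
by exists N => n /hN; rewrite last_traj_site.
Qed.

Lemma walk_eventually_goes_left (R : realType) :
  walk_eventually (fun M x => x <= - M%:Z) (fun _ i => i) =
  [set z : env R * env R | goes_left (arrows z) 0].
Proof.
apply/seteqP; split=> z /=.
  move=> h; apply/le_natP => M; have [N hN] := h M.
  by exists N => n /hN; rewrite last_traj_site.
move=> /le_natP h M; have [N hN] := h M.
by exists N => n /hN; rewrite last_traj_site.
Qed.

Theorem theorem1p1 (R : realType) (mu : probability (env R) R)
  (d : measure_display) (S : measurableType d) (P : probability S R)
  (W : S -> env R) (U : nat -> S -> R) :
  stationary mu -> ergodic mu -> elliptic mu ->
  annealed_coupling P mu W U ->
  (P (Aplus W U) = 0%E \/ P (Aplus W U) = 1%E) /\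
  (P (Aminus W U) = 0%E \/ P (Aminus W U) = 1%E).
Proof.
move=> mu_stat mu_erg _ WU.
have [sigma [rk [rkK sigmaK]]] := exists_enumeration.
have sigma_surj i : exists k, sigma k = i by exists (rk i); rewrite rkK.
split.
- pose Phi (M : nat) (x : int) : Prop := M%:Z <= x.
  have PhiS M x : Phi M.+1 x -> Phi M x by rewrite /Phi; lia.
  have [nu [nu_iid PE]] := eventually_erw_measure WU rkK sigmaK PhiS.
  have mE := measurable_walk_eventually (R := R) Phi (fun _ i => i).
  have -> : P (Aplus W U) = (mu \x nu)%E (walk_eventually Phi (fun _ i => i)).
    by rewrite -PE; congr (P _); apply/seteqP; split=> s /ge_natP.
  apply: (monotone_event_01 mu_stat mu_erg sigma_surj (can_inj sigmaK) nu_iid mE).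
  by rewrite walk_eventually_goes_right => z; exact: goes_right_pair_shift.
- pose Phi (M : nat) (x : int) : Prop := x <= - M%:Z.
  have PhiS M x : Phi M.+1 x -> Phi M x by rewrite /Phi; lia.
  have [nu [nu_iid PE]] := eventually_erw_measure WU rkK sigmaK PhiS.
  have mE := measurable_walk_eventually (R := R) Phi (fun _ i => i).
  have -> : P (Aminus W U) = (mu \x nu)%E (walk_eventually Phi (fun _ i => i)).
    by rewrite -PE; congr (P _); apply/seteqP; split=> s /le_natP.
  apply: (antitone_event_01 mu_stat mu_erg sigma_surj (can_inj sigmaK) nu_iid mE).
  by rewrite walk_eventually_goes_left => z; exact: goes_left_pair_shift.
Qed.
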